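(* Let $\alpha>0$, $\beta>0$ and $\varkappa\geq 1$ be real parameters and, for $\xi\in[0,2\pi]$, let $$G(\xi)=\begin{pmatrix}1-\omega_1 & -\mathbf{i}\omega_2\\ -\mathbf{i}\omega_2 & 1-\varkappa\omega_1\end{pmatrix},\qquad \omega_1=4\alpha\beta\sin^2\frac{\xi}{2},\quad \omega_2=\beta\sin\xi .$$ Then the von Neumann type spectral condition $$\max_{0\leq\xi\leq 2\pi}\ \max_{l}\big|\lambda_l\big(G(\xi)\big)\big|\leq 1$$ holds if and only if $$\beta\leq\min\Big\{(\varkappa+1)\alpha,\ \frac{1}{2\varkappa\alpha}\Big\}.$$
   Context: Here $\mathbf{i}$ is the imaginary unit and $\lambda_l(A)$ denote the (complex) eigenvalues of a square matrix $A$. The matrix $G(\xi)$ is the amplification matrix (symbol, obtained by substituting $\mathbf{y}^m_k=e^{\mathbf{i}k\xi}\mathbf{v}^m(\xi)$) of the linearized explicit two-level finite-difference scheme for $\mathbf{y}^m=(\rho^m\ u^m)^T$ on the mesh indexed by $k\in\mathbb{Z}$: $$\mathbf{y}^{m+1}_k=\begin{pmatrix}\alpha\beta&\frac{\beta}{2}\\ \frac{\beta}{2}&\varkappa\alpha\beta\end{pmatrix}\mathbf{y}^m_{k-1}+\begin{pmatrix}1-2\alpha\beta&0\\0&1-2\varkappa\alpha\beta\end{pmatrix}\mathbf{y}^m_k+\begin{pmatrix}\alpha\beta&-\frac{\beta}{2}\\-\frac{\beta}{2}&\varkappa\alpha\beta\end{pmatrix}\mathbf{y}^m_{k+1}.$$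 *)

(* Defs.v *)
From HB Require Import structures.
From mathcomp Require Import all_boot all_order all_algebra.
From mathcomp Require Import all_classical all_reals all_analysis.
From mathcomp Require Import complex.

Set Implicit Arguments.
Unset Strict Implicit.
Unset Printing Implicit Defensive.

Import Order.TTheory GRing.Theory Num.Theory.
Import numFieldNormedType.Exports.

Local Open Scope classical_set_scope.
Local Open Scope ring_scope.

Definition is_max (R : realType) (S : set R) (M : R) : Prop :=
  S M /\ ubound S M.

(* [eigenvalue] refers to row eigenvectors, but the eigenvalues of a square
   matrix are the same on either side. *)
Definition eigenvalue_moduli (R : realType) (n : nat) (A : 'M[R[i]]_n) :
    set R :=
  [set ComplexField.Normc.normc l | l in [set l : R[i] | eigenvalue A l]].

Definition is_spectral_radius (R : realType) (n : nat) (A : 'M[R[i]]_n)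
    (r : R) : Prop :=
  is_max (eigenvalue_moduli A) r.

Definition omega1 (R : realType) (alpha beta xi : R) : R :=
  4 * alpha * beta * sin (xi / 2) ^+ 2.

Definition omega2 (R : realType) (beta xi : R) : R := beta * sin xi.

Definition mx2 (T : Type) (a b c d : T) : 'M[T]_2 :=
  \matrix_(i, j) if i == ord0 then (if j == ord0 then a else b)
                 else (if j == ord0 then c else d).

(* Symbol of the scheme: the substitution y_k = e^(i k xi) v turns one time
   step into v |-> G v, with v a column vector. *)
Definition amplification_mx (R : realType) (alpha beta kappa xi : R) :
    'M[R[i]]_2 :=
  let w1 := omega1 alpha beta xi in
  let w2 := omega2 beta xi in
  mx2 (1 - w1)%:C%C            (- ('i%C * w2%:C%C))
      (- ('i%C * w2%:C%C))     (1 - kappa * w1)%:C%C.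

(* The nested maximum over xi in [0, 2 pi] and over the eigenvalues is a
   genuine maximum: it is attained, at both levels, and equal to M. *)
Definition is_max_spectral_radius (R : realType) (alpha beta kappa M : R) :
    Prop :=
  is_max [set r | exists2 xi : R, 0 <= xi <= 2 * pi &
            is_spectral_radius (amplification_mx alpha beta kappa xi) r] M.

Definition von_neumann_condition (R : realType) (alpha beta kappa : R) :
    Prop :=
  exists2 M : R, is_max_spectral_radius alpha beta kappa M & M <= 1.

(* Main.v *)
Require Import Defs.
From mathcomp Require Import all_boot all_order all_algebra.
From mathcomp Require Import all_classical all_reals all_analysis.
From mathcomp Require Import complex.
From mathcomp Require Import ring lra.
(** The characteristic polynomial of the symbol at [xi] is
    [l ^+ 2 - t * l + p] with real trace [t] and real determinant [p], so its
    spectral radius has a closed form in [t] and [p] ([quad_radius]).  This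
    form is continuous in [xi], hence attains its maximum on [[0, 2 pi]], and
    the von Neumann condition reduces to the pointwise bound: spectral radius
    at most 1 for every [xi] ([von_neumann_conditionE]).

    For a real quadratic, both roots lie in the closed unit disk if and only if
    [`|t| <= 1 + p] and [p <= 1] ([quad_radius_le1]).  Put
    [s = sin (xi / 2) ^+ 2], which runs over all of [[0, 1]].  The condition
    [t <= 1 + p] is automatic, and the other two become ([amp_radius_le1])
    - from [- t <= 1 + p]:
      [0 <= (1 - 2 alpha beta s) (1 - 2 kappa alpha beta s)
            + beta^2 s (1 - s)],
    - from [p <= 1], after a division by [4 beta]:
      [s (4 kappa alpha^2 beta s + beta (1 - s)) <= s (kappa + 1) alpha].

    For [s > 0] the second one bounds a convex combination of
    [4 kappa alpha^2 beta] and [beta] by [(kappa + 1) alpha].  Letting [s]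
    tend to 0 gives [beta <= (kappa + 1) alpha].  At [s = 1] it gives
    [4 kappa alpha beta <= kappa + 1], which forces the smaller of the two
    products [2 alpha beta], [2 kappa alpha beta] to be at most 1, with equality
    only if [kappa = 1]; the first condition at [s = 1] then gives
    [2 kappa alpha beta <= 1].  Conversely
    these two bounds on [beta] imply both conditions for every [s]. *)

Set Implicit Arguments.
Unset Strict Implicit.
Unset Printing Implicit Defensive.

Import Order.TTheory GRing.Theory Num.Theory.
Import numFieldNormedType.Exports.
Local Open Scope ring_scope.

(** * Real quadratic polynomials and the closed unit disk *)

Lemma eigenvalue_mx2 (F : fieldType) (a b c d l : F) :
  eigenvalue (mx2 a b c d) l = ((l - a) * (l - d) - b * c == 0).
Proof.
rewrite eigenvalue_root_char /root; congr (_ == 0).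
rewrite /char_poly (expand_det_row _ ord0) !big_ord_recl big_ord0.
rewrite /cofactor !det_mx11.
rewrite !mxE /= !mulr1n !mulr0n !add0n expr0 expr1.
by rewrite !hornerE /=; ring.
Qed.

(** With discriminant [d], the complex number [sqrt d + i sqrt (- d)] is a
    square root of [d] whatever its sign, because the real square root vanishes
    on negative numbers.  This gives the roots of [l ^+ 2 - t * l + p] without
    a case distinction, by an expression visibly continuous in [t] and [p]. *)
Definition quad_root1 (R : realType) (t p : R) : R[i] :=
  let d := t ^+ 2 - 4 * p in
  ((t + Num.sqrt d) / 2 +i* (Num.sqrt (- d) / 2))%C.

Definition quad_root2 (R : realType) (t p : R) : R[i] :=
  let d := t ^+ 2 - 4 * p in
  ((t - Num.sqrt d) / 2 +i* (- (Num.sqrt (- d) / 2)))%C.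

Lemma sqrt_clampM (R : realType) (d : R) : Num.sqrt d * Num.sqrt (- d) = 0.
Proof.
have [d0|/ltW d0] := leP 0 d; last by rewrite (ler0_sqrtr d0) mul0r.
by rewrite (ler0_sqrtr (_ : - d <= 0)) ?mulr0 // oppr_le0.
Qed.

Lemma sqrt_clampB (R : realType) (d : R) :
  Num.sqrt d ^+ 2 - Num.sqrt (- d) ^+ 2 = d.
Proof.
have [d0|/ltW d0] := leP 0 d.
  by rewrite (ler0_sqrtr (_ : - d <= 0)) ?oppr_le0 // sqr_sqrtr //; ring.
by rewrite (ler0_sqrtr d0) sqr_sqrtr ?oppr_ge0 //; ring.
Qed.

Lemma quad_factor (R : realType) (t p : R) (l : R[i]) :
  l ^+ 2 - t%:C%C * l + p%:C%C = (l - quad_root1 t p) * (l - quad_root2 t p).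
Proof.
have rD : quad_root1 t p + quad_root2 t p = t%:C%C.
  apply/eqP; rewrite eq_complex /=; apply/andP; split; apply/eqP; lra.
have rM : quad_root1 t p * quad_root2 t p = p%:C%C.
  have eM := sqrt_clampM (t ^+ 2 - 4 * p).
  have eB := sqrt_clampB (t ^+ 2 - 4 * p).
  apply/eqP; rewrite eq_complex /=; apply/andP; split; apply/eqP; lra.
by rewrite -rD -rM; ring.
Qed.

Definition quad_radius (R : realType) (t p : R) : R :=
  Num.max (ComplexField.Normc.normc (quad_root1 t p))
          (ComplexField.Normc.normc (quad_root2 t p)).

(** Real roots [(t +- a) / 2] lie in [[-1, 1]] if and only if
    [a <= 2 - t] and [a <= 2 + t]; the squares of these inequalities are the
    two halves of [`|t| <= 1 + p], because
    [(2 -+ t) ^+ 2 - a ^+ 2 = 4 * (1 -+ t + p)], and [p <= 1] is what excludes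
    a pair of roots beyond the same end of [[-1, 1]].  Conjugate roots both
    have squared modulus [p], and [t ^+ 2 <= 4 * p <= (1 + p) ^+ 2] makes the
    condition on [t] automatic. *)
Lemma quad_radius_le1 (R : realType) (t p : R) :
  quad_radius t p <= 1 <-> `|t| <= 1 + p /\ p <= 1.
Proof.
rewrite /quad_radius ge_max /ComplexField.Normc.normc /=.
rewrite -sqrtr1 !ler_sqrt // !sqrtr1.
have eM := sqrt_clampM (t ^+ 2 - 4 * p).
have eB := sqrt_clampB (t ^+ 2 - 4 * p).
have := sqrtr_ge0 (t ^+ 2 - 4 * p); have := sqrtr_ge0 (- (t ^+ 2 - 4 * p)).
move: eM eB; set a := Num.sqrt _; set b := Num.sqrt _ => eM eB b0 a0.
rewrite ler_norml; move/eqP: eM; rewrite mulf_eq0 => /orP[/eqP a00|/eqP b00].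
  (* Conjugate roots: the discriminant is [- b ^+ 2]. *)
  rewrite a00 in eB *; split=> [/andP[h1 h2]|[h1 h2]]; last first.
    by apply/andP; split; lra.
  have p1 : p <= 1 by lra.
  have p0 : 0 <= p by have := sqr_ge0 t; have := sqr_ge0 b; lra.
  split=> //; rewrite -ler_norml -ler_sqr ?nnegrE //; last lra.
  rewrite real_normK ?num_real //.
  by have := sqr_ge0 (1 - p); have := sqr_ge0 b; lra.
(* Real roots: the discriminant is [a ^+ 2]. *)
rewrite b00 in eB *; split=> [/andP[h1 h2]|[/andP[h1 h2] h3]].
  have /andP[g1 g2] : -2 <= t + a <= 2.
    by rewrite -ler_norml -ler_sqr ?nnegrE ?normr_ge0 //
      real_normK ?num_real //; lra.
  have /andP[g3 g4] : -2 <= t - a <= 2.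
    by rewrite -ler_norml -ler_sqr ?nnegrE ?normr_ge0 //
      real_normK ?num_real //; lra.
  have k1 : 0 <= (2 - (t + a)) * (2 - (t - a)) by apply: mulr_ge0; lra.
  have k2 : 0 <= (2 + (t + a)) * (2 + (t - a)) by apply: mulr_ge0; lra.
  have a2 := sqr_ge0 a.
  by split; [apply/andP; split|]; lra.
have k1 : a <= 2 - t by rewrite -ler_sqr ?nnegrE //; lra.
have k2 : a <= 2 + t by rewrite -ler_sqr ?nnegrE //; lra.
by apply/andP; split; nra.
Qed.

(** * The spectral radius of the amplification matrix *)

Definition amp_tr (R : realType) (alpha beta kappa xi : R) : R :=
  2 - (kappa + 1) * omega1 alpha beta xi.

Definition amp_det (R : realType) (alpha beta kappa xi : R) : R :=
  (1 - omega1 alpha beta xi) * (1 - kappa * omega1 alpha beta xi)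
  + omega2 beta xi ^+ 2.

Definition amp_radius (R : realType) (alpha beta kappa xi : R) : R :=
  quad_radius (amp_tr alpha beta kappa xi) (amp_det alpha beta kappa xi).

Lemma eigenvalue_amplification (R : realType) (alpha beta kappa xi : R)
    (l : R[i]) :
  eigenvalue (amplification_mx alpha beta kappa xi) l =
  (l == quad_root1 (amp_tr alpha beta kappa xi) (amp_det alpha beta kappa xi))
  || (l == quad_root2 (amp_tr alpha beta kappa xi)
                      (amp_det alpha beta kappa xi)).
Proof.
rewrite eigenvalue_mx2 -[X in _ || X]subr_eq0 -[X in X || _]subr_eq0 -mulf_eq0.
rewrite -quad_factor; congr (_ == 0).
rewrite /amp_tr /amp_det; move: (omega1 _ _ _) (omega2 _ _) => w v.
case: l => x y; apply/eqP; rewrite eq_complex /=.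
by apply/andP; split; apply/eqP; ring.
Qed.

Lemma spectral_radius_amplification (R : realType) (alpha beta kappa xi r : R) :
  is_spectral_radius (amplification_mx alpha beta kappa xi) r <->
  r = amp_radius alpha beta kappa xi.
Proof.
set t := amp_tr alpha beta kappa xi; set p := amp_det alpha beta kappa xi.
have rad : is_spectral_radius (amplification_mx alpha beta kappa xi)
             (amp_radius alpha beta kappa xi).
  split.
    rewrite /amp_radius /quad_radius /Num.max.
    case: ifP => _; [exists (quad_root2 t p) | exists (quad_root1 t p)] => //=.
      by rewrite eigenvalue_amplification eqxx orbT.
    by rewrite eigenvalue_amplification eqxx.
  move=> _ [l /= + <-]; rewrite eigenvalue_amplification => /orP[]/eqP->.
    by rewrite le_max lexx.
  by rewrite le_max lexx orbT.
split=> [[r_in r_ub]|-> //]; apply: le_anti.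
by rewrite (rad.2 _ r_in) (r_ub _ rad.1).
Qed.

(** Continuity matters only because the von Neumann condition asks for a maximum
    that is attained. *)
Lemma continuous_amp_radius (R : realType) (alpha beta kappa : R) :
  continuous (amp_radius alpha beta kappa).
Proof.
have cexpr2 (f : R -> R) : continuous f -> continuous (fun x => f x ^+ 2).
  by move=> cf x; apply: (continuousM (cf x) (cf x)).
have csqrt (f : R -> R) : continuous f -> continuous (fun x => Num.sqrt (f x)).
  by move=> cf x; apply: (continuous_comp (cf x)); apply: sqrt_continuous.
have cD (f g : R -> R) : continuous f -> continuous g ->
    continuous (fun x => f x + g x).
  by move=> cf cg x; apply: (continuousD (cf x) (cg x)).
have cN (f : R -> R) : continuous f -> continuous (fun x => - f x).
  by move=> cf x; apply: (continuousN (cf x)).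
have cM (f g : R -> R) : continuous f -> continuous g ->
    continuous (fun x => f x * g x).
  by move=> cf cg x; apply: (continuousM (cf x) (cg x)).
have cC (c : R) : continuous (fun _ : R => c).
  by move=> x; apply: cst_continuous.
have csin (f : R -> R) : continuous f -> continuous (fun x => sin (f x)).
  by move=> cf x; apply: (continuous_comp (cf x)); apply: continuous_sin.
have cid : continuous (fun x : R => x) by move=> x.
have cmax (f g : R -> R) : continuous f -> continuous g ->
    continuous (fun x => Num.max (f x) (g x)).
  by move=> cf cg x; apply: (continuous_max (cf x) (cg x)).
have cw : continuous (omega1 alpha beta).
  exact: (cM _ _ (cC _) (cexpr2 _ (csin _ (cM _ _ cid (cC _))))).
have ct : continuous (amp_tr alpha beta kappa).
  exact: (cD _ _ (cC 2) (cN _ (cM _ _ (cC _) cw))).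
have cp : continuous (amp_det alpha beta kappa).
  apply: (cD (fun x => (1 - omega1 alpha beta x)
                       * (1 - kappa * omega1 alpha beta x))).
    exact: (cM _ _ (cD _ _ (cC 1) (cN _ cw))
                   (cD _ _ (cC 1) (cN _ (cM _ _ (cC _) cw)))).
  exact: (cexpr2 _ (cM _ _ (cC _) (csin _ cid))).
have cd : continuous (fun x => amp_tr alpha beta kappa x ^+ 2
                               - 4 * amp_det alpha beta kappa x).
  exact: (cD _ _ (cexpr2 _ ct) (cN _ (cM _ _ (cC 4) cp))).
have cim := cM _ _ (csqrt _ (cN _ cd)) (cC 2^-1).
have cre1 := cM _ _ (cD _ _ ct (csqrt _ cd)) (cC 2^-1).
have cre2 := cM _ _ (cD _ _ ct (cN _ (csqrt _ cd))) (cC 2^-1).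
exact: (cmax _ _ (csqrt _ (cD _ _ (cexpr2 _ cre1) (cexpr2 _ cim)))
                 (csqrt _ (cD _ _ (cexpr2 _ cre2) (cexpr2 _ (cN _ cim))))).
Qed.

Lemma von_neumann_conditionE (R : realType) (alpha beta kappa : R) :
  von_neumann_condition alpha beta kappa <->
  forall xi, 0 <= xi <= 2 * pi -> amp_radius alpha beta kappa xi <= 1.
Proof.
split=> [[M [_ M_ub] M1] xi xi_in|le1].
  apply: le_trans M1; apply: M_ub; exists xi => //.
  by apply/spectral_radius_amplification.
have pi2 : 0 <= 2 * pi :> R by rewrite mulr_ge0 // pi_ge0.
have [|c c_in c_max] := EVT_max (f := amp_radius alpha beta kappa) pi2.
  by apply: continuous_subspaceT; apply: continuous_amp_radius.
rewrite in_itv in c_in.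
exists (amp_radius alpha beta kappa c); last exact: le1.
split; first by exists c => //; apply/spectral_radius_amplification.
move=> _ [xi xi_in /spectral_radius_amplification ->].
by apply: c_max; rewrite in_itv.
Qed.

(** * Reduction to the variable [sin (xi / 2) ^+ 2] *)

Lemma omega2_sqrE (R : realType) (beta xi : R) :
  let s := sin (xi / 2) ^+ 2 in
  omega2 beta xi ^+ 2 = 4 * beta ^+ 2 * s * (1 - s).
Proof.
rewrite /= -cos2sin2 /omega2 [in LHS](_ : xi = xi / 2 *+ 2); last first.
  by rewrite -mulr_natr; field.
by rewrite sin_mulr2n -mulr_natr; ring.
Qed.

(** [1 - t + p = kappa * omega1 ^+ 2 + omega2 ^+ 2] is nonnegative, which
    disposes of one of the three inequalities.  The factor [s] on both
    sides of the last one cannot be cancelled: at [s = 0] the symbol is the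
    identity matrix, which constrains nothing. *)
Lemma amp_radius_le1 (R : realType) (alpha beta kappa xi s : R) :
  0 < beta -> 0 <= kappa -> sin (xi / 2) ^+ 2 = s ->
  amp_radius alpha beta kappa xi <= 1 <->
  0 <= (1 - 2 * alpha * beta * s) * (1 - 2 * kappa * alpha * beta * s)
       + beta ^+ 2 * s * (1 - s) /\
  s * (4 * kappa * alpha ^+ 2 * beta * s + beta * (1 - s))
  <= s * ((kappa + 1) * alpha).
Proof.
move=> beta0 kappa0 sE.
rewrite -(ler_pM2l (_ : 0 < 4 * beta) (s * _)) ?mulr_gt0 //.
have mu_ge0 : 0 <= kappa * omega1 alpha beta xi ^+ 2 + omega2 beta xi ^+ 2.
  by apply: addr_ge0; [apply: mulr_ge0|]; rewrite ?sqr_ge0.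
apply: (iff_trans (quad_radius_le1 _ _)); rewrite /amp_tr /amp_det ler_norml.
move: mu_ge0; rewrite omega2_sqrE /omega1 sE => mu_ge0.
split=> [[/andP[h1 h2] h3]|[h1 h2]]; first by split; lra.
by split; [apply/andP; split|]; lra.
Qed.

(** [xi = 2 * asin (sqrt s)] works; it even lies in [[0, pi]]. *)
Lemma sin2_half_onto (R : realType) (s : R) : 0 <= s <= 1 ->
  exists2 xi : R, 0 <= xi <= 2 * pi & sin (xi / 2) ^+ 2 = s.
Proof.
move=> /andP[s0 s1]; have q0 := sqrtr_ge0 s.
have q1 : Num.sqrt s <= 1 by rewrite -sqrtr1 ler_sqrt.
have q_in : -1 <= Num.sqrt s <= 1 by rewrite q1 andbT; lra.
exists (2 * asin (Num.sqrt s)); last first.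
  by rewrite mulrC mulKf ?pnatr_eq0 // asinK ?in_itv // sqr_sqrtr.
have le_pi2 := asin_lepi2 q_in; have pi0 := pi_ge0 R.
suff : 0 <= asin (Num.sqrt s) by move=> ?; apply/andP; split; lra.
rewrite leNgt; apply/negP => a0; have : sin (- asin (Num.sqrt s)) > 0.
  apply: sin_gt0_pi; apply/andP.
  by have := asin_geNpi2 q_in; have := pi_gt0 R; lra.
by rewrite sinN asinK ?in_itv //; lra.
Qed.

Theorem theorem1 (R : realType) (alpha beta kappa : R)
    (halpha : 0 < alpha) (hbeta : 0 < beta) (hkappa : 1 <= kappa) :
  von_neumann_condition alpha beta kappa <->
  beta <= Num.min ((kappa + 1) * alpha) (1 / (2 * kappa * alpha)).
Proof.
have ka0 : 0 < 2 * kappa * alpha by rewrite !mulr_gt0 //; lra.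
have kappa0 : 0 <= kappa by lra.
have alpha0 := ltW halpha; have beta0 := ltW hbeta.
rewrite le_min ler_pdivlMr //.
apply: (iff_trans (von_neumann_conditionE _ _ _)).
split=> [le1|/andP[b1 b2] xi _]; last first.
  have s0 : 0 <= sin (xi / 2) ^+ 2 := sqr_ge0 _.
  have s1 : 0 <= 1 - sin (xi / 2) ^+ 2 by rewrite -cos2sin2 sqr_ge0.
  apply/(amp_radius_le1 _ hbeta kappa0 erefl).
  move: (sin (xi / 2) ^+ 2) s0 s1 => s s0 s1.
  have ab0 : 0 <= alpha * beta * s by do ?apply: mulr_ge0.
  have kab1 : 2 * kappa * alpha * beta * s <= 1.
    have : 0 <= s * (1 - beta * (2 * kappa * alpha)) by apply: mulr_ge0; lra.
    lra.
  have ab_kab : alpha * beta * s <= kappa * (alpha * beta * s).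
    by rewrite ler_peMl.
  split.
    by apply: addr_ge0; do ?apply: mulr_ge0 => //; rewrite ?sqr_ge0 //; lra.
  apply: ler_wpM2l => //.
  (* The claim is a sum of three inequalities: the two bounds on [beta],
     weighted by [s] and [1 - s], and [2 <= kappa + 1]. *)
  have hs : 0 <= alpha * s * (1 - beta * (2 * kappa * alpha)).
    by do ?apply: mulr_ge0 => //; lra.
  have hc : 0 <= (1 - s) * ((kappa + 1) * alpha - beta).
    by rewrite mulr_ge0 // subr_ge0.
  have hk : 0 <= alpha * s * (kappa - 1) by do ?apply: mulr_ge0 => //; lra.
  lra.
have cond s : 0 <= s <= 1 ->
    0 <= (1 - 2 * alpha * beta * s) * (1 - 2 * kappa * alpha * beta * s)
         + beta ^+ 2 * s * (1 - s) /\
    s * (4 * kappa * alpha ^+ 2 * beta * s + beta * (1 - s))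
    <= s * ((kappa + 1) * alpha).
  by case/sin2_half_onto=> xi /le1 + sE => /(amp_radius_le1 _ hbeta kappa0 sE).
apply/andP; split; rewrite leNgt; apply/negP => gt_beta.
  (* Small enough that [beta * (1 - s)], the midpoint of [beta] and
     [(kappa + 1) * alpha], still exceeds the latter. *)
  pose s := (beta - (kappa + 1) * alpha) / (2 * beta).
  have ka1 : 0 < (kappa + 1) * alpha by rewrite mulr_gt0 //; lra.
  have s0 : 0 < s by rewrite divr_gt0 ?mulr_gt0 ?subr_gt0.
  have sE : 2 * (beta * s) = beta - (kappa + 1) * alpha.
    by rewrite /s; field; rewrite gt_eqF.
  have s1 : s <= 1 by rewrite ler_pdivrMr ?mulr_gt0 //; lra.
  clearbody s; have s_in : 0 <= s <= 1 by rewrite (ltW s0).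
  have [_] := cond s s_in.
  rewrite ler_pM2l // => le_ka.
  have : 0 <= 4 * kappa * alpha ^+ 2 * beta * s.
    by do ?apply: mulr_ge0 => //; lra.
  lra.
have one_in : 0 <= (1 : R) <= 1 by rewrite ler01 lexx.
have [] := cond 1 one_in.
rewrite !mul1r !mulr1 subrr !mulr0 !addr0 => det_ge0.
have -> : 4 * kappa * alpha ^+ 2 * beta = 4 * kappa * alpha * beta * alpha.
  by ring.
rewrite ler_pM2r // => le_k.
(* As [2 * kappa * alpha * beta > 1], the product of the two factors can be
   nonnegative only if the other factor is nonpositive too; with [le_k] this
   leaves only [kappa = 1] and [2 * alpha * beta <= 1], a contradiction. *)
have ab_ge1 : 1 <= 2 * alpha * beta.
  rewrite leNgt; apply/negP => ab_lt1.
  have : 0 < (1 - 2 * alpha * beta) * (beta * (2 * kappa * alpha) - 1).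
    by rewrite mulr_gt0 ?subr_gt0.
  lra.
have hk : 0 <= kappa * (2 * alpha * beta - 1) by rewrite mulr_ge0 // subr_ge0.
have kappa1 : kappa = 1 by lra.
rewrite kappa1 in gt_beta le_k; lra.
Qed.
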